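(* Under hypotheses (H1), (H2), (H3) of the context, every solution $(\boldsymbol u_h,\varrho_h,\varsigma_h,\beta_h)$ of the semi-discrete scheme (S) of the context preserves the total mass: $\int_\Omega\varrho_h$ is constant in time.
   Context: Setting. $\Omega\subset\mathbb{R}^n$ ($n=2,3$) is a domain with boundary $\partial\Omega$ regular enough for Stokes' theorem; $X(\Omega)$ is the set of vector fields on $\Omega$ tangent to $\partial\Omega$. $d$ is the exterior derivative, $\star$ the Hodge operator, $i_{\boldsymbol u}$ the interior product with a vector field $\boldsymbol u$. $e=e(\rho,s)$ is a given smooth function (internal energy), with partial derivatives $\partial_\rho e$, $\partial_s e$. An $n$-form $\varrho=\rho\,dV$ is identified with its scalar density $\rho$ whenever it is an argument of $e$ or multiplies another $n$-form or a vector field inside an integrand; e.g. $\int_\Omega(\varrho\boldsymbol u)\cdot\boldsymbol v=\int_\Omega\rho\,\boldsymbol u\cdot\boldsymbol v\,dV$. (H1) $V_h^0,\dots,V_h^n$ are finite-dimensional spaces, $V_h^i$ consisting of $i$-forms on $\Omega$ on which $d$ is well defined, with $d(V_h^i)\subset V_h^{i+1}$. (H2) There are linear projection operators $\Pi^i$ onto $V_h^i$, $0\le i\le n$ (with domain containing all the forms to which they are applied below), which preserve the vanishing of forms at the boundary: if $\alpha$ has vanishing trace (pullback) on $\partial\Omega$, so does $\Pi^i\alpha$. $X_h\subset X(\Omega)$ is a finite-dimensional vector space of discrete vector fields. Let $$\mathfrak g_h=\{(A^0,\dots,A^n)\in L(V_h^0)\times\cdots\times L(V_h^n):\ dA^{i-1}=A^i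 d\},$$ with $L(V)$ the linear endomorphisms of $V$, and bracket $[A,B]^i=A^iB^i-B^iA^i$. For $\boldsymbol u_h\in X_h$, $A_{\boldsymbol u_h}=(A^0_{\boldsymbol u_h},\dots,A^n_{\boldsymbol u_h})\in\mathfrak g_h$ is defined by $$A^i_{\boldsymbol u_h}\alpha_h=d\,\Pi^{i-1}(i_{\boldsymbol u_h}\alpha_h)+\Pi^i(i_{\boldsymbol u_h}d\alpha_h),\qquad \alpha_h\in V_h^i,$$ (the first term is $0$ for $i=0$, the second is $0$ for $i=n$). (H3) The map $\boldsymbol u_h\mapsto A_{\boldsymbol u_h}$ from $X_h$ to $\mathfrak g_h$ is injective and a linear left inverse $\hat{\cdot}:\mathfrak g_h\to X_h$ is fixed: $\widehat{A_{\boldsymbol u_h}}=\boldsymbol u_h$ for all $\boldsymbol u_h\in X_h$. Semi-discrete scheme (S): find (smooth in time) curves $\boldsymbol u_h(t)\in X_h$, $\varrho_h(t),\varsigma_h(t)\in V_h^n$, $\beta_h(t)\in V_h^{n-1}$ such that $$ \int_\Omega \partial_t(\varrho_h\boldsymbol{u}_h)\cdot\boldsymbol{v}_h-(\varrho_h\boldsymbol{u}_h)\cdot\widehat{[A_{\boldsymbol{v}_h},A_{\boldsymbol{u}_h}]}+\Big(\tfrac12|\boldsymbol{u}_h|^2-e(\varrho_h,\varsigma_h)-\varrho_h\partial_{\varrho_h}e(\varrho_h,\varsigma_h)\Big)A^n_{\boldsymbol{v}_h}\varrho_h-\varrho_h\partial_{\varsigma_h}e(\varrho_h,\varsigma_h)A^n_{\boldsymbol{v}_h}\varsigma_h-\beta_h\wedge\star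 A^{n-1}_{\boldsymbol{v}_h}\beta_h=0\quad\forall\,\boldsymbol v_h\in X_h, $$ $$ \partial_t\varrho_h+A^n_{\boldsymbol u_h}\varrho_h=0,\qquad \partial_t\varsigma_h+A^n_{\boldsymbol u_h}\varsigma_h=0,\qquad \partial_t\beta_h+A^{n-1}_{\boldsymbol u_h}\beta_h=0 . $$ *)

(* Defs.v *)
From HB Require Import structures.
From mathcomp Require Import all_boot all_order all_algebra.
From mathcomp Require Import all_classical all_reals all_analysis.

Set Implicit Arguments.
Unset Strict Implicit.
Unset Printing Implicit Defensive.

Import Order.TTheory GRing.Theory Num.Theory.
Import numFieldNormedType.Exports.

Local Open Scope classical_set_scope.
Local Open Scope ring_scope.

(* Exterior algebra of R^n in coordinates.  An element sum_I a_I dx_I, where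
   dx_I = dx_{i1} /\ ... /\ dx_{ik} for I = {i1 < ... < ik}, is the function
   I |-> a_I; a differential form is a field of such elements. *)
Notation ext R n := ({set 'I_n} -> R).
Notation dform R n := ('rV[R]_n -> {set 'I_n} -> R).
Notation vfield R n := ('rV[R]_n -> 'rV[R]_n).

Section ExteriorAlgebra.
Context {R : realType} {n : nat}.
Implicit Types (a b : ext R n) (v w : 'rV[R]_n).

Definition dotp v w : R := \sum_k v 0 k * w 0 k.

(* dx_I /\ dx_J = shuffle_sign I J dx_(I u J) for disjoint I and J. *)
Definition shuffle_sign (I J : {set 'I_n}) : R :=
  (-1) ^+ #|[set p in finset.setX I J | (p.2 < p.1)%N]|.

Definition ext_wedge a b : ext R n := fun K =>
  \sum_(I : {set 'I_n} | I \subset K)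
     shuffle_sign I (K :\: I) * a I * b (K :\: I).

(* Normalised by dx_I /\ hodge dx_I = dx_1 /\ ... /\ dx_n. *)
Definition hodge a : ext R n := fun J =>
  shuffle_sign (~: J)%SET J * a (~: J)%SET.

Definition flat_form v : ext R n := fun I =>
  \sum_k v 0 k * (I == [set k]%SET)%:R.

Definition ext_contract v a : ext R n := fun J =>
  \sum_(k | k \notin J) shuffle_sign [set k]%SET J * v 0 k * a (k |: J).

(* a(v_1, ..., v_k) for a of degree k and vs = [:: v_1; ...; v_k]. *)
Definition evalf a (vs : seq 'rV[R]_n) : R :=
  foldl (fun b v => ext_contract v b) a vs finset.set0.

(* The coefficient of dV of an element of degree n. *)
Definition dV_coef a : R := a [set: 'I_n]%SET.

Definition degree_form (i : nat) (al : dform R n) : Prop :=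
  forall x (I : {set 'I_n}), #|I| != i -> al x I = 0.

Definition interior_prod (X : vfield R n) (al : dform R n) : dform R n :=
  fun x => ext_contract (X x) (al x).

End ExteriorAlgebra.

Definition iter_derive {R : realType} {V : normedModType R} (vs : seq V)
    (f : V -> R) : V -> R :=
  foldr (fun v g => fun x => 'D_v g x) f vs.

(* C^infinity on an open set U of a finite-dimensional V. *)
Definition smooth_on {R : realType} {V : normedModType R} (U : set V)
    (f : V -> R) : Prop :=
  forall (vs : seq V) (x : V), U x ->
    {for x, continuous (iter_derive vs f)} /\
    forall v, derivable (iter_derive vs f) x v.

Notation borelV R n := (g_sigma_algebraType (@open 'rV[R]_n)).

(* This determines vol among the Borel measures of R^n. *)
Definition is_lebesgue {R : realType} {n : nat}
    (vol : {measure set (borelV R n) -> \bar R}) : Prop :=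
  forall a b : 'rV[R]_n, (forall k, a 0 k <= b 0 k) ->
    vol [set x : 'rV[R]_n | forall k, a 0 k < x 0 k <= b 0 k] =
    (\prod_k (b 0 k - a 0 k))%:E.

Section Domain.
Context {R : realType} {n : nat}.
Variable vol : {measure set (borelV R n) -> \bar R}.
Variable Om : set 'rV[R]_n.

Definition bdry : set 'rV[R]_n := closure Om `\` Om.

Definition test_function (phi : 'rV[R]_n -> R) : Prop :=
  smooth_on setT phi /\
  exists K : set 'rV[R]_n,
    [/\ compact K, K `<=` Om & forall x, ~ K x -> phi x = 0].

(* be = d al on Om in the sense of distributions, from
   (d al)_K = sum_(k in K) shuffle_sign {k} (K \ k) d_k al_(K \ k). *)
Definition ext_derivative (al be : dform R n) : Prop :=
  forall phi, test_function phi -> forall K : {set 'I_n},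
    \int[vol]_(x in Om) (be x K * phi x) =
    - \sum_(k in K) shuffle_sign [set k]%SET (K :\ k) *
        \int[vol]_(x in Om) (al x (K :\ k) * 'D_(delta_mx 0 k) phi x).

(* sigma is the surface measure of the boundary, nu the unit outward normal. *)
Variable sigma : {measure set (borelV R n) -> \bar R}.
Variable nu : vfield R n.

Definition bdry_value (f : 'rV[R]_n -> R) (x : 'rV[R]_n) : Prop :=
  f y @[y --> within Om (nbhs x)] --> f x.

(* Forms are given with their values on the boundary, which are required to be
   the limits from inside Om at sigma-almost every boundary point: this holds
   for piecewise smooth forms on a mesh, and gives a meaning to their trace. *)
Definition regular_form (al : dform R n) : Prop :=
  forall I : {set 'I_n},
  [/\ measurable_fun (closure Om : set (borelV R n))
        (fun x : borelV R n => al x I),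
      exists M : R, forall x, Om x -> `|al x I| <= M,
      vol.-integrable Om (EFin \o (fun x => al x I)) &
      {ae sigma, forall x, bdry x -> bdry_value (fun y => al y I) x}].

(* The pullback of the k-form al to the boundary is zero. *)
Definition vanishing_trace (k : nat) (al : dform R n) : Prop :=
  {ae sigma, forall x, bdry x ->
    (forall I : {set 'I_n}, bdry_value (fun y => al y I) x) /\
    forall vs : k.-tuple 'rV[R]_n,
      (forall j, dotp (tnth vs j) (nu x) = 0) -> evalf (al x) vs = 0}.

Definition tangent_field (X : vfield R n) : Prop :=
  {ae sigma, forall x, bdry x ->
    (forall k, bdry_value (fun y => X y 0 k) x) /\ dotp (X x) (nu x) = 0}.

(* The pullback of an (n-1)-form to the boundary, as a density with respect to
   sigma: the boundary is oriented so that nu^flat_form /\ (area form) = dV. *)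
Definition bdry_density (al : dform R n) : 'rV[R]_n -> R :=
  fun x => dV_coef (ext_wedge (flat_form (nu x)) (al x)).

Record stokes_domain : Prop := {
  dom_open : open Om;
  dom_connected : connected Om;
  dom_nonempty : Om !=set0;
  sigma_locally_finite : forall K : set 'rV[R]_n, compact K ->
    (sigma K < +oo)%E;
  sigma_bdry : sigma (~` bdry) = 0%E;
  nu_measurable : forall k,
    measurable_fun setT (fun x : borelV R n => nu x 0 k);
  nu_unit : {ae sigma, forall x, bdry x -> dotp (nu x) (nu x) = 1};
  stokes_formula : forall al be : dform R n,
    degree_form n.-1 al -> degree_form n be ->
    regular_form al -> regular_form be -> ext_derivative al be ->
    sigma.-integrable bdry (EFin \o bdry_density al) ->
    \int[vol]_(x in Om) dV_coef (be x) =
    \int[sigma]_(x in bdry) bdry_density al x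
}.

End Domain.

Section Discretization.
Context {R : realType} {n : nat}.
Variable vol sigma : {measure set (borelV R n) -> \bar R}.
Variables (Om : set 'rV[R]_n) (nu : vfield R n).

(* V_h^i is an abstract finite-dimensional space V i with an injective linear
   map fm i into forms, injectivity being modulo equality almost everywhere; dh
   is then the restriction of d.  The index ranges over nat: fm_degree and
   fm_inj force V i to be zero for i > n. *)
Variables (V : nat -> vectType R) (fm : forall i, {linear V i -> dform R n}).
Variable dh : forall i, {linear V i -> V i.+1}.

Record discrete_forms : Prop := {
  fm_degree : forall i (a : V i), degree_form i (fm i a);
  fm_inj : forall i (a : V i),
    {ae vol, forall x, Om x -> fm i a x = 0} -> a = 0;
  fm_regular : forall i (a : V i), regular_form vol Om sigma (fm i a);
  dhE : forall i (a : V i), ext_derivative vol Om (fm i a) (fm i.+1 (dh i a))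
}.

Variables (X : vectType R) (vf : {linear X -> vfield R n}).

Record discrete_fields : Prop := {
  vf_inj : forall u : X, {ae vol, forall x, Om x -> vf u x = 0} -> u = 0;
  vf_tangent : forall u : X, tangent_field Om sigma nu (vf u)
}.

(* D i is the domain of the projection Pi i; values outside are irrelevant. *)
Variables (D : forall i : nat, set (dform R n)).
Variable Pi : forall i, dform R n -> V i.

Record trace_projections : Prop := {
  D_degree : forall i al, D i al -> degree_form i al;
  D_lin : forall i (c : R) al be, D i al -> D i be -> D i (c *: al + be);
  D_fm : forall i (a : V i), D i (fm i a);
  D_interior : forall i (u : X) (a : V i.+1),
    D i (interior_prod (vf u) (fm i.+1 a));
  Pi_lin : forall i (c : R) al be, D i al -> D i be ->
    Pi i (c *: al + be) = c *: Pi i al + Pi i be;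
  Pi_proj : forall i (a : V i), Pi i (fm i a) = a;
  Pi_trace : forall i al, D i al ->
    vanishing_trace Om sigma nu i al ->
    vanishing_trace Om sigma nu i (fm i (Pi i al))
}.

Definition gh (A : forall i, V i -> V i) : Prop :=
  (forall i, linear (A i)) /\ (forall i a, dh i (A i a) = A i.+1 (dh i a)).

Definition gh_bracket (A B : forall i, V i -> V i) : forall i, V i -> V i :=
  fun i a => A i (B i a) - B i (A i a).

(* For i = n the last term vanishes, as fm n.+1 (dh n a) has degree n+1. *)
Definition Aop (u : X) : forall i, V i -> V i := fun i =>
  match i return V i -> V i with
  | 0%N => fun a => Pi 0%N (interior_prod (vf u) (fm 1%N (dh 0%N a)))
  | j.+1 => fun a =>
      dh j (Pi j (interior_prod (vf u) (fm j.+1 a))) +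
      Pi j.+1 (interior_prod (vf u) (fm j.+2 (dh j.+1 a)))
  end.

(* Only the values of hat on gh matter. *)
Variable hat : (forall i, V i -> V i) -> X.

Record gh_left_inverse : Prop := {
  Aop_inj : injective Aop;
  hat_lin : forall (c : R) A B, gh A -> gh B ->
    hat (fun i a => c *: A i a + B i a) = c *: hat A + hat B;
  hatK : forall u, hat (Aop u) = u
}.

(* c extends smoothly to an open neighbourhood of J; if J has an end point, the
   time derivative there is then the one-sided one. *)
Definition smooth_curve (W : vectType R) (J : set R) (c : R -> W) : Prop :=
  exists U : set R, [/\ open U, J `<=` U &
    forall k,
      smooth_on U (fun t => coord (vbasis (fullv : {vspace W})) k (c t))].

Definition curve_derive (W : vectType R) (c : R -> W) (t : R) : W :=
  \sum_(k < \dim (fullv : {vspace W}))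
     derive1 (fun s => coord (vbasis (fullv : {vspace W})) k (c s)) t
       *: (vbasis (fullv : {vspace W}))`_k.

Definition scalar_density (r : V n) (x : 'rV[R]_n) : R := dV_coef (fm n r x).

Variables (E : set (R * R)) (e : R * R -> R).

Definition de_rho (r s : R) : R := derive1 (fun r' => e (r', s)) r.
Definition de_s (r s : R) : R := derive1 (fun s' => e (r, s')) s.

Definition momentum_integrand (u : R -> X) (rho vs : R -> V n)
    (beta : R -> V n.-1) (t : R) (v : X) (x : 'rV[R]_n) : R :=
  let r := scalar_density (rho t) x in
  let s := scalar_density (vs t) x in
  let uv := gh_bracket (Aop v) (Aop (u t)) in
  (\sum_k derive1 (fun t' => scalar_density (rho t') x * vf (u t') x 0 k) t
            * vf v x 0 k)
  - r * dotp (vf (u t) x) (vf (hat uv) x)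
  + (2^-1 * dotp (vf (u t) x) (vf (u t) x) - e (r, s) - r * de_rho r s)
      * scalar_density (@Aop v n (rho t)) x
  - r * de_s r s * scalar_density (@Aop v n (vs t)) x
  - dV_coef (ext_wedge (fm n.-1 (beta t) x)
               (hodge (fm n.-1 (@Aop v n.-1 (beta t)) x))).

Record scheme_solution (J : set R) (u : R -> X) (rho vs : R -> V n)
    (beta : R -> V n.-1) : Prop := {
  u_smooth : smooth_curve J u;
  rho_smooth : smooth_curve J rho;
  vs_smooth : smooth_curve J vs;
  beta_smooth : smooth_curve J beta;
  state_dom : forall t, J t -> {ae vol, forall x, Om x ->
    E (scalar_density (rho t) x, scalar_density (vs t) x)};
  momentum_integrable : forall t v, J t ->
    vol.-integrable Om (EFin \o momentum_integrand u rho vs beta t v);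
  momentum_eq : forall t v, J t ->
    \int[vol]_(x in Om) momentum_integrand u rho vs beta t v x = 0;
  rho_eq : forall t, J t -> curve_derive rho t + @Aop (u t) n (rho t) = 0;
  vs_eq : forall t, J t -> curve_derive vs t + @Aop (u t) n (vs t) = 0;
  beta_eq : forall t, J t ->
    curve_derive beta t + @Aop (u t) n.-1 (beta t) = 0
}.

End Discretization.

(* Main.v *)
Require Import Defs.
From HB Require Import structures.
From mathcomp Require Import all_boot all_order all_algebra.
From mathcomp Require Import all_classical all_reals all_analysis.
From mathcomp Require Import measurable_realfun ring.

(** The total mass is a linear functional of the discrete density, so along a
    solution its time derivative is minus the mass of [A^n_u rho].  There is no
    nonzero discrete form of degree n+1, so
    [A^n_u rho = d (Pi^(n-1) (i_u rho))], and Stokes' formula turns its mass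
    into the flux of [Pi^(n-1) (i_u rho)] through the boundary.

    This flux vanishes.  At a boundary point the tangent hyperplane has
    dimension n-1 and contains [u], so a form of degree n vanishes on [u]
    followed by n-1 tangent vectors (lemma [evalf_top_tangent]): [i_u rho] has
    vanishing trace, and the projection preserves this.  Conversely, an
    (n-1)-form that vanishes on all tangent (n-1)-tuples has zero boundary
    density (lemma [wedge_flat_eq0]).  Hence the mass has zero derivative on an
    interval of times, and is constant there.

    Both pointwise facts come from two identities for the contractions [i_v]:
    they anticommute, and [i_v (w /\ a) = <v, w> a - w /\ i_v a].  If [nu] is a
    unit vector and [nu /\ c = 0], as for every form [c] of top degree, the
    second one gives [c = nu /\ i_nu c]; and contractions with vectors
    orthogonal to [nu] commute up to sign with [nu /\ _].  No determinant or
    basis of the hyperplane is needed. *)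

Set Implicit Arguments.
Unset Strict Implicit.
Unset Printing Implicit Defensive.

Import Order.TTheory GRing.Theory Num.Theory.
Import numFieldNormedType.Exports.

Local Open Scope classical_set_scope.
Local Open Scope ring_scope.

(** * Contractions and exterior products with a covector *)

Section ExtAlg.
Context {R : realType} {n : nat}.
Implicit Types (a b : ext R n) (v w : 'rV[R]_n) (J K : {set 'I_n}).

(** The parity of the number of elements of [J] below [k], as a sign: for [k]
    outside [J] it is the one relating dx_k /\ dx_J to dx_({k} u J).  The value
    is the same for [J], [J] with [k] added and [J] with [k] removed. *)
Definition sgn (k : 'I_n) J : R := (-1 : R) ^+ (\sum_(j in J) (j < k)%N).

Lemma shuffle_sign1 k J : shuffle_sign [set k]%SET J = sgn k J.
Proof.
rewrite /shuffle_sign /sgn; congr (_ ^+ _).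
rewrite -big_mkcondr /= sum1dep_card.
have -> : [set p in finset.setX [set k] J | (p.2 < p.1)%N]%SET =
    [set (k, j) | j in [set j in J | (j < k)%N]]%SET.
  apply/setP => -[i j]; rewrite !inE /=; apply/idP/imsetP.
    move=> /andP[/andP[/eqP -> jJ] jk].
    by exists j => //; rewrite inE jJ.
  by move=> [j' + [-> ->]]; rewrite inE eqxx.
by rewrite card_imset // => i j [].
Qed.

Lemma sgnU1 k l J : l \notin J ->
  sgn k (l |: J)%SET = (-1 : R) ^+ (l < k)%N * sgn k J.
Proof. by move=> lJ; rewrite /sgn big_setU1 //= exprD. Qed.

Lemma sgnU1_id k J : sgn k (k |: J)%SET = sgn k J.
Proof.
have [kJ|kJ] := boolP (k \in J).
  by rewrite (finset.setUidPr _) // finset.sub1set.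
by rewrite sgnU1 // ltnn mul1r.
Qed.

Lemma sgnD1 k l J : l \in J ->
  sgn k (J :\ l)%SET = (-1 : R) ^+ (l < k)%N * sgn k J.
Proof.
move=> lJ; rewrite -[in RHS](finset.setD1K lJ) sgnU1 ?finset.setD11 //.
by rewrite mulrA -expr2 sqrr_sign mul1r.
Qed.

Lemma sgnD1_id k J : sgn k (J :\ k)%SET = sgn k J.
Proof.
have [kJ|kJ] := boolP (k \in J); first by rewrite sgnD1 // ltnn mul1r.
by congr sgn; apply/finset.setDidPl; rewrite disjoint_sym disjoints1.
Qed.

Lemma sgn2 k J : sgn k J * sgn k J = 1.
Proof. by rewrite /sgn -expr2 sqrr_sign. Qed.

Lemma sgn_ltnC (k l : 'I_n) : k != l ->
  (-1 : R) ^+ (k < l)%N = - (-1 : R) ^+ (l < k)%N :> R.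
Proof.
move=> kl; case: (ltngtP k l) => /=; rewrite ?expr0 ?expr1 ?opprK //.
by move=> /val_inj e; rewrite e eqxx in kl.
Qed.

Lemma ext_contractE v a J :
  ext_contract v a J = \sum_(k | k \notin J) sgn k J * v 0 k * a (k |: J)%SET.
Proof. by apply: eq_bigr => k _; rewrite shuffle_sign1. Qed.

Lemma wedge_flatE v a K :
  ext_wedge (flat_form v) a K = \sum_(k in K) sgn k K * v 0 k * a (K :\ k)%SET.
Proof.
rewrite /ext_wedge /flat_form.
under eq_bigr do rewrite mulr_sumr mulr_suml.
rewrite exchange_big /= [RHS]big_mkcond /=; apply: eq_bigr => k _.
case: ifPn => kK.
  rewrite (bigD1 [set k]%SET) ?finset.sub1set //= eqxx mulr1.
  rewrite shuffle_sign1 sgnD1_id.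
  rewrite big1 ?addr0 // => I /andP[_ /negPf ->].
  by rewrite !mulr0 mul0r.
rewrite big1 // => I IK; case: eqP => [e|_]; last by rewrite !mulr0 mul0r.
by move: kK IK; rewrite e finset.sub1set => /negPf ->.
Qed.

Lemma ext_addE a b J : (a + b) J = a J + b J. Proof. by []. Qed.
Lemma ext_oppE a J : (- a) J = - a J. Proof. by []. Qed.
Lemma ext_scaleE (c : R) a J : (c *: a) J = c * a J. Proof. by []. Qed.

Lemma ext_contractDl v w a :
  ext_contract (v + w) a = ext_contract v a + ext_contract w a.
Proof.
apply/funext => J; rewrite ext_addE !ext_contractE -big_split /=.
by apply: eq_bigr => k _; rewrite mxE; ring.
Qed.

Lemma ext_contractZl c v a : ext_contract (c *: v) a = c *: ext_contract v a.
Proof.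
apply/funext => J; rewrite ext_scaleE !ext_contractE mulr_sumr /=.
by apply: eq_bigr => k _; rewrite mxE; ring.
Qed.

Lemma ext_contractZr c v a : ext_contract v (c *: a) = c *: ext_contract v a.
Proof.
apply/funext => J; rewrite ext_scaleE !ext_contractE mulr_sumr /=.
by apply: eq_bigr => k _; rewrite ext_scaleE; ring.
Qed.

Lemma ext_contract0r v : ext_contract v 0 = 0.
Proof. by rewrite -(scale0r 0) ext_contractZr !scale0r. Qed.

Lemma ext_contractNr v a : ext_contract v (- a) = - ext_contract v a.
Proof. by rewrite -scaleN1r ext_contractZr scaleN1r. Qed.

(** Contractions anticommute. *)
Lemma ext_contractC v w a :
  ext_contract v (ext_contract w a) = - ext_contract w (ext_contract v a).
Proof.
apply/funext => J; rewrite ext_oppE !ext_contractE.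
under eq_bigr do rewrite ext_contractE mulr_sumr.
under [in RHS]eq_bigr do rewrite ext_contractE mulr_sumr.
rewrite (exchange_big_dep (fun l => l \notin J)) /=; last first.
  by move=> k l _; rewrite !inE negb_or => /andP[].
rewrite -sumrN; apply: eq_bigr => l lJ; rewrite -sumrN.
apply: eq_big => [k|k]; first by rewrite !inE !negb_or eq_sym lJ andbT andbC.
move=> /andP[kJ]; rewrite !inE negb_or => /andP[lk _].
rewrite !sgnU1 // (sgn_ltnC lk) finset.setUCA; ring.
Qed.

Lemma ext_contract_id v a : ext_contract v (ext_contract v a) = 0.
Proof.
have /eqP := ext_contractC v v a.
rewrite -addr_eq0 -mulr2n -scaler_nat scaler_eq0 pnatr_eq0 /=.
by move=> /eqP.
Qed.

(** A contraction is an antiderivation, here with a factor of degree 1. *)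
Lemma ext_contract_wedge v w a :
  ext_contract v (ext_wedge (flat_form w) a) =
  dotp v w *: a - ext_wedge (flat_form w) (ext_contract v a).
Proof.
apply/funext => J; rewrite ext_addE ext_oppE ext_scaleE wedge_flatE.
rewrite ext_contractE.
(* Off-diagonal terms: they occur in both sums, with opposite signs. *)
set T := fun k l => sgn k J * sgn l J * (-1 : R) ^+ (k < l)%N *
  v 0 k * w 0 l * a (k |: (J :\ l))%SET.
have -> : \sum_(k | k \notin J) sgn k J * v 0 k *
      ext_wedge (flat_form w) a (k |: J)%SET =
    (\sum_(k | k \notin J) v 0 k * w 0 k) * a J +
    \sum_(k | k \notin J) \sum_(l in J) T k l.
  rewrite mulr_suml -big_split /=; apply: eq_bigr => k kJ.
  rewrite wedge_flatE big_setU1 //= mulrDr finset.setU1K // sgnU1_id.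
  rewrite mulr_sumr; congr (_ + _).
    by rewrite -[RHS]mul1r -(sgn2 k J); ring.
  apply: eq_bigr => l lJ; rewrite /T sgnU1 //.
  rewrite finset.setDUl (finset.setDidPl _) //; first by ring.
  by rewrite disjoints1 finset.inE; apply: contraNneq kJ => ->.
have -> : \sum_(l in J) sgn l J * w 0 l * ext_contract v a (J :\ l)%SET =
    (\sum_(l in J) v 0 l * w 0 l) * a J -
    \sum_(k | k \notin J) \sum_(l in J) T k l.
  rewrite exchange_big mulr_suml -sumrN -big_split /=; apply: eq_bigr => l lJ.
  rewrite ext_contractE (bigD1 l) ?finset.setD11 //= mulrDr.
  rewrite finset.setD1K // sgnD1_id mulr_sumr -sumrN; congr (_ + _).
    by rewrite -[RHS]mul1r -(sgn2 l J); ring.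
  apply: eq_big => [k|k].
    rewrite !finset.inE negb_and negbK.
    by case: eqVneq => [->|] //=; rewrite ?andbT ?andbF ?lJ.
  by move=> /andP[_ kl]; rewrite /T sgnD1 // (sgn_ltnC kl); ring.
rewrite /dotp [\sum_k _](bigID (mem J) xpredT) /=; ring.
Qed.

Lemma wedge_flatZ c v a :
  ext_wedge (flat_form v) (c *: a) = c *: ext_wedge (flat_form v) a.
Proof.
apply/funext => K; rewrite ext_scaleE !wedge_flatE mulr_sumr.
by apply: eq_bigr => k _; rewrite ext_scaleE; ring.
Qed.

Lemma wedge_flat0 v : ext_wedge (flat_form v) 0 = 0.
Proof. by rewrite -(scale0r 0) wedge_flatZ !scale0r. Qed.

(** [a] is homogeneous of degree [d]: [degree_form] at one point. *)
Definition homog d a := forall I : {set 'I_n}, #|I| != d -> a I = 0.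

Lemma homog_contract d v a : homog d.+1 a -> homog d (ext_contract v a).
Proof.
move=> ha J Jd; rewrite ext_contractE big1 // => k kJ.
by rewrite ha ?mulr0 // cardsU1 kJ.
Qed.

Lemma homog0_contract v a : homog 0 a -> ext_contract v a = 0.
Proof.
move=> ha; apply/funext => J; rewrite ext_contractE big1 // => k kJ.
by rewrite ha ?mulr0 // cardsU1 kJ.
Qed.

Lemma homog_wedge_flat d v a : homog d a ->
  homog d.+1 (ext_wedge (flat_form v) a).
Proof.
move=> ha K Kd; rewrite wedge_flatE big1 // => k kK.
rewrite ha ?mulr0 //; apply: contraNneq Kd => <-.
by rewrite [#|K|](cardsD1 k) kK.
Qed.

Lemma homog_gt d a : homog d a -> (n < d)%N -> a = 0.
Proof.
move=> ha nd; apply/funext => I; apply: ha; rewrite neq_ltn.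
by rewrite (leq_ltn_trans (max_card _)) // card_ord.
Qed.

(** Iterated contraction: the partial evaluation [a(v_1, ..., v_k, _)] for
    [vs = [:: v_1; ...; v_k]], of which [evalf] is the component of degree 0. *)
Definition contracts (vs : seq 'rV[R]_n) a :=
  foldl (fun b v => ext_contract v b) a vs.

Lemma contracts0 vs : contracts vs 0 = 0.
Proof. by elim: vs => //= v vs IH; rewrite ext_contract0r. Qed.

Lemma contracts_gt d vs a : homog d a -> (d < size vs)%N -> contracts vs a = 0.
Proof.
elim: vs d a => [|v vs IH] // [|d] a ha; rewrite [contracts _ _]/=.
  by rewrite homog0_contract // contracts0.
by rewrite ltnS; apply/IH/homog_contract.
Qed.

Lemma contracts_homog d vs a :
  homog (d + size vs)%N a -> homog d (contracts vs a).
Proof.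
elim: vs d a => [|v vs IH] d a /=; first by rewrite addn0.
by rewrite addnS => /(homog_contract v)/IH.
Qed.

Lemma contractsZ c vs a : contracts vs (c *: a) = c *: contracts vs a.
Proof. by elim: vs a => //= v vs IH a; rewrite ext_contractZr IH. Qed.

Lemma contracts_wedge_flat nu vs a : (forall v, v \in vs -> dotp v nu = 0) ->
  contracts vs (ext_wedge (flat_form nu) a) =
  (-1 : R) ^+ size vs *: ext_wedge (flat_form nu) (contracts vs a).
Proof.
elim: vs a => [|v vs IH] a hvs /=; first by rewrite scale1r.
rewrite ext_contract_wedge (hvs v) ?mem_head // scale0r sub0r.
rewrite -scaleN1r contractsZ IH ?scalerA ?exprS // => w wvs.
by apply: hvs; rewrite in_cons wvs orbT.
Qed.

Lemma contracts_contract w vs a :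
  contracts vs (ext_contract w a) =
  (-1 : R) ^+ size vs *: ext_contract w (contracts vs a).
Proof.
elim: vs a => [|v vs IH] a /=; first by rewrite scale1r.
by rewrite ext_contractC -scaleN1r contractsZ IH scalerA exprS.
Qed.

(** Any [n] vectors of the hyperplane orthogonal to [nu] are dependent, so a
    form of top degree vanishes on them. *)
Lemma evalf_top_tangent nu vs a : dotp nu nu = 1 -> homog n a ->
  (n <= size vs)%N -> (forall v, v \in vs -> dotp v nu = 0) -> evalf a vs = 0.
Proof.
move=> nu1 ha hsz hvs; rewrite /evalf -/(contracts vs a).
(* nu /\ a has degree n + 1, hence is zero. *)
have -> : a = ext_wedge (flat_form nu) (ext_contract nu a).
  have := ext_contract_wedge nu nu a.
  rewrite (homog_gt (homog_wedge_flat nu ha)) // ext_contract0r nu1 scale1r.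
  by move/eqP; rewrite eq_sym subr_eq0 => /eqP.
rewrite contracts_wedge_flat //.
suff -> : contracts vs (ext_contract nu a) = 0.
  by rewrite wedge_flat0 scaler0.
exact: (@contracts_gt n (nu :: vs)).
Qed.

(** A form is determined by its values, indeed by those on basis vectors. *)
Lemma evalf_eq0 d a : homog d a ->
  (forall vs : d.-tuple 'rV[R]_n, evalf a vs = 0) -> a = 0.
Proof.
move=> ha h; apply/funext => I; have [Id|/ha //] := eqVneq #|I| d.
elim: d a I ha Id h => [|d IH] a I ha Id h.
  by rewrite (cards0_eq Id); apply: (h (nil_tuple _)).
have /card_gt0P[k kI] : (0 < #|I|)%N by rewrite Id.
have := IH (ext_contract (delta_mx 0 k) a) (I :\ k)%SET
  (homog_contract _ ha) _ _.
rewrite ext_contractE (bigD1 k) ?finset.setD11 //= finset.setD1K //.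
rewrite big1; last first.
  by move=> l /andP[_ /negPf lk]; rewrite mxE lk andbF mulr0 mul0r.
rewrite mxE !eqxx mulr1 addr0 => /(_ _ _)/eqP.
rewrite mulf_eq0 signr_eq0 /= => e; apply/eqP/e.
  by move: Id; rewrite (cardsD1 k) kI => -[].
by move=> vs; exact: (h [tuple of delta_mx 0 k :: vs]).
Qed.

(** For a unit vector [nu], the orthogonal projection onto its orthogonal
    hyperplane. *)
Definition tangent_part nu v := v - dotp v nu *: nu.

Lemma tangent_part_dotp nu v : dotp nu nu = 1 ->
  dotp (tangent_part nu v) nu = 0.
Proof.
move=> nu1; rewrite /dotp.
under eq_bigr do rewrite !mxE mulrBl -mulrA.
by rewrite sumrB -mulr_sumr -!/(dotp _ _) nu1 mulr1 subrr.
Qed.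

(** After a contraction with [nu], normal components no longer matter, since
    [i_nu i_nu = 0]. *)
Lemma contracts_tangent_part nu vs a :
  contracts (map (tangent_part nu) vs) (ext_contract nu a) =
  contracts vs (ext_contract nu a).
Proof.
elim: vs a => //= v vs IH a; rewrite [tangent_part nu v]/tangent_part.
rewrite -scaleNr ext_contractDl ext_contractZl.
by rewrite ext_contract_id scaler0 addr0 ext_contractC -ext_contractNr IH.
Qed.

(** An (n-1)-form that vanishes on the hyperplane orthogonal to [nu] is
    annihilated by [nu /\ _].  With [c = nu /\ a], of top degree, the values of
    [i_nu c] only depend on tangential parts, and on those they reduce to values
    of [a]; so [i_nu c = 0], and then [c = nu /\ i_nu c = 0]. *)
Lemma wedge_flat_eq0 nu d a : dotp nu nu = 1 -> n = d.+1 -> homog d a ->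
  (forall vs : d.-tuple 'rV[R]_n,
     (forall j, dotp (tnth vs j) nu = 0) -> evalf a vs = 0) ->
  ext_wedge (flat_form nu) a = 0.
Proof.
move=> nu1 nd ha h; set c := ext_wedge _ _.
have hc : homog d.+1 c by exact: homog_wedge_flat.
have nuc : ext_wedge (flat_form nu) c = 0.
  by apply: (@homog_gt d.+2); rewrite ?nd //; exact: homog_wedge_flat.
suff ic0 : ext_contract nu c = 0.
  have := ext_contract_wedge nu nu c.
  by rewrite nuc ic0 ext_contract0r wedge_flat0 nu1 scale1r subr0.
apply: (@evalf_eq0 d); first exact: homog_contract.
move=> vs; rewrite /evalf -/(contracts _ _) -(@contracts_tangent_part nu).
pose ws := map_tuple (tangent_part nu) vs.
have tws j : dotp (tnth ws j) nu = 0 by rewrite tnth_map tangent_part_dotp.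
rewrite contracts_contract contracts_wedge_flat; last first.
  by move=> _ /mapP[v _ ->]; exact: tangent_part_dotp.
suff -> : contracts (map (tangent_part nu) vs) a = 0.
  by rewrite wedge_flat0 scaler0 ext_contract0r scaler0.
apply/funext => I; have [/eqP|I0] := eqVneq #|I| 0%N.
  by rewrite cards_eq0 => /eqP ->; exact: (h ws tws).
by apply: (@contracts_homog 0) I0; rewrite add0n size_map size_tuple.
Qed.

End ExtAlg.

(** * Boundary flux *)

Lemma cvg_sum_cond {R : realType} {T : Type} {F : set_system T} {FF : Filter F}
    (I : finType) (P : pred I) (f : I -> T -> R) (l : I -> R) :
  (forall i, P i -> f i x @[x --> F] --> l i) ->
  (\sum_(i | P i) f i x) @[x --> F] --> \sum_(i | P i) l i.
Proof.
move=> h; elim: (index_enum I) => [|i s IH].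
  rewrite big_nil; under eq_fun do rewrite big_nil; exact: cvg_cst.
rewrite big_cons; under eq_fun do rewrite big_cons.
by case: ifPn => Pi //; apply: cvgD => //; exact: h.
Qed.

Section Boundary.
Context {R : realType} {n : nat}.
Implicit Types (Om : set 'rV[R]_n).
Implicit Types (vol sigma : {measure set (borelV R n) -> \bar R}).

#[local] Instance ae_borelV_filter sigma :
  Filter (nbhs (almost_everywhere sigma)) :=
  ae_filter_ringOfSetsType sigma.

Lemma open_borelV (U : set 'rV[R]_n) :
  open U -> measurable (U : set (borelV R n)).
Proof. by move=> oU; exact: sub_sigma_algebra. Qed.

Lemma closure_borelV (U : set 'rV[R]_n) :
  measurable (closure U : set (borelV R n)).
Proof.
rewrite -(setCK (closure U)); apply: measurableC; apply: open_borelV.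
exact/closed_openC/closed_closure.
Qed.

Lemma bdry_borelV Om : open Om -> measurable (bdry Om : set (borelV R n)).
Proof.
by move=> oOm; apply: measurableD; [exact: closure_borelV|exact: open_borelV].
Qed.

Lemma regular_form_bdry_value vol Om sigma (al : dform R n) :
  regular_form vol Om sigma al ->
  {ae sigma, forall x, bdry Om x ->
    forall I, bdry_value Om (fun y => al y I) x}.
Proof.
move=> hal.
have : \forall x \ae sigma, forall I, bdry Om x ->
    bdry_value Om (fun y => al y I) x.
  by apply: filter_forall => I; have [_ _ _] := hal I.
by apply: filterS => x h bx I; exact: h.
Qed.

(** On the boundary, [X] and the arguments of the trace all lie in one
    hyperplane. *)
Lemma vanishing_trace_interior_prod vol Om sigma (nu X : vfield R n)
    (al : dform R n) (d : nat) :
  n = d.+1 ->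
  {ae sigma, forall x, bdry Om x -> dotp (nu x) (nu x) = 1} ->
  tangent_field Om sigma nu X ->
  degree_form n al -> regular_form vol Om sigma al ->
  vanishing_trace Om sigma nu d (interior_prod X al).
Proof.
move=> nd nu1 tX dal /regular_form_bdry_value ral.
apply: filterS3 nu1 tX ral => x nu1 tX ral bx.
have {}nu1 := nu1 bx; have [cX Xnu] := tX bx; have {}ral := ral bx.
split=> [I|ws tws].
  rewrite /bdry_value /interior_prod /ext_contract.
  apply: cvg_sum_cond => k kI; apply: cvgM; last exact: ral.
  by apply: cvgM; [exact: cvg_cst|exact: cX].
rewrite /interior_prod -[LHS]/(evalf (al x) (X x :: ws)).
apply: (@evalf_top_tangent _ _ (nu x)) => //; first exact: dal.
  by rewrite /= size_tuple nd.
by move=> v; rewrite in_cons => /predU1P[->//|/tnthP[j ->]].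
Qed.

Lemma bdry_density_eq0 Om sigma (nu : vfield R n) (al : dform R n) (d : nat) :
  n = d.+1 ->
  {ae sigma, forall x, bdry Om x -> dotp (nu x) (nu x) = 1} ->
  degree_form d al -> vanishing_trace Om sigma nu d al ->
  {ae sigma, forall x, bdry Om x -> bdry_density nu al x = 0}.
Proof.
move=> nd nu1 dal tal; apply: filterS2 nu1 tal => x nu1 tal bx.
have [_ {}tal] := tal bx.
by rewrite /bdry_density (wedge_flat_eq0 (nu1 bx) nd (dal x)).
Qed.

Lemma measurable_bdry_density vol Om sigma (nu : vfield R n) (al : dform R n) :
  open Om ->
  (forall k, measurable_fun setT (fun x : borelV R n => nu x 0 k)) ->
  regular_form vol Om sigma al ->
  measurable_fun (bdry Om : set (borelV R n))
    (bdry_density nu al : borelV R n -> R).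
Proof.
move=> oOm mnu ral.
have mal I : measurable_fun (bdry Om : set (borelV R n))
    (fun x : borelV R n => al x I).
  have [mI _ _ _] := ral I.
  apply: measurable_funS mI; [exact: closure_borelV|exact: subDsetl].
have -> : bdry_density nu al = (fun x => \sum_(k : 'I_n)
    @sgn R n k [set: 'I_n]%SET * nu x 0 k * al x ([set: 'I_n] :\ k)%SET).
  apply/funext => x; rewrite /bdry_density /dV_coef wedge_flatE.
  by apply: eq_bigl => k; rewrite finset.in_setT.
apply: measurable_sum => k.
apply: measurable_funM; last exact: mal.
apply: measurable_funM; first exact: measurable_cst.
exact: measurable_funTS.
Qed.

Lemma stokes_vanishing_trace vol Om sigma (nu : vfield R n)
    (al be : dform R n) :
  stokes_domain vol Om sigma nu -> (0 < n)%N ->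
  degree_form n.-1 al -> degree_form n be ->
  regular_form vol Om sigma al -> regular_form vol Om sigma be ->
  ext_derivative vol Om al be -> vanishing_trace Om sigma nu n.-1 al ->
  \int[vol]_(x in Om) dV_coef (be x) = 0.
Proof.
move=> hOm n0 dal dbe ral rbe dalbe tal.
have mb := bdry_borelV (dom_open hOm).
have z := bdry_density_eq0 (esym (prednK n0)) (nu_unit hOm) dal tal.
have md := measurable_bdry_density (dom_open hOm) (nu_measurable hOm) ral.
have mE : measurable_fun (bdry Om : set (borelV R n))
  (EFin \o (bdry_density nu al : borelV R n -> R)) by exact/measurable_EFinP.
have aez : ae_eq sigma (bdry Om) (cst 0%E) (EFin \o bdry_density nu al).
  by apply: filterS z => x h /h /= ->.
have int0 : (\int[sigma]_(x in bdry Om) (EFin \o bdry_density nu al) x = 0)%E.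
  by rewrite -(ae_eq_integral _ _ _ _ _ aez) ?integral0.
rewrite (stokes_formula hOm dal dbe ral rbe dalbe).
  by rewrite /Rintegral int0.
(* Measurable and almost everywhere zero, the density is integrable. *)
apply/integrableP; split => //.
rewrite (ae_eq_integral (cst 0%E)) //; first by rewrite integral0.
  exact: measurableT_comp.
by apply: filterS z => x h /h /= ->; rewrite normr0.
Qed.

End Boundary.

(** * Evolution of the total mass *)

Section LinearCurve.
Context {R : realType} (W : vectType R).

Lemma is_derive_scalar_curve (L : {scalar W}) (J : set R) (c : R -> W)
    (t : R) :
  smooth_curve J c -> J t -> is_derive t 1 (L \o c) (L (curve_derive c t)).
Proof.
move=> [U [_ JU sc]] Jt.
set e := vbasis (fullv : {vspace W}).
have -> : L \o c = \sum_(k < \dim (fullv : {vspace W}))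
    L e`_k *: (fun s => coord e k (c s)).
  apply/funext => s; rewrite fct_sumE /= {1}(coord_vbasis (memvf (c s))).
  rewrite linear_sum.
  by apply: eq_bigr => k _; rewrite linearZ /= mulrC.
rewrite /curve_derive linear_sum.
apply: is_derive_sum => k; rewrite linearZ /= mulrC; apply: is_deriveZ.
have [_ /(_ 1) dk] := sc k [::] t (JU t Jt).
by rewrite derive1E; exact: derivableP.
Qed.

End LinearCurve.

Section Mass.
Context {R : realType} {n : nat} {V : nat -> vectType R}
  {fm : forall i, {linear V i -> dform R n}}
  {dh : forall i, {linear V i -> V i.+1}}.
Implicit Types (vol sigma : {measure set (borelV R n) -> \bar R}).

(** The integral of a discrete density over the domain. *)
Definition total_mass vol Om (a : V n) : R :=
  \int[vol]_(x in Om) scalar_density fm a x.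

Lemma total_mass_scalar vol sigma Om : open Om ->
  discrete_forms vol sigma Om fm dh -> scalar (total_mass vol Om).
Proof.
move=> oOm H1 c a b; have mOm := open_borelV oOm.
have int (w : V n) : vol.-integrable Om (EFin \o scalar_density fm w).
  by have [_ _ ? _] := fm_regular H1 w [set: 'I_n]%SET.
rewrite /total_mass -RintegralZl // -RintegralD //.
  by congr Rintegral; apply/funext => x; rewrite /scalar_density linearP.
exact: (integrableZl mOm c (int a)).
Qed.

Lemma dh_top vol sigma Om (a : V n) :
  discrete_forms vol sigma Om fm dh -> dh n a = 0.
Proof.
move=> H1; apply: (fm_inj H1); apply: aeW => x _.
exact: (homog_gt (fm_degree H1 (dh n a) x)).
Qed.

Context {X : vectType R} {vf : {linear X -> vfield R n}}
  {D : forall i : nat, set (dform R n)} {Pi : forall i, dform R n -> V i}.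

Lemma Pi0 sigma Om nu i :
  trace_projections sigma Om nu fm vf D Pi -> Pi i 0 = 0.
Proof. by move=> H2; rewrite -(linear0 (fm i)) (Pi_proj H2). Qed.

End Mass.

(** The mass of [A^n_u a] is the boundary flux of [Pi^(n-1) (i_u a)], which is
    zero.  The dimension is written as a successor for [Aop] to reduce. *)
Lemma total_mass_Aop {R : realType} {d : nat} {V : nat -> vectType R}
    (vol sigma : {measure set (borelV R d.+1) -> \bar R}) (Om : set 'rV[R]_d.+1)
    (nu : vfield R d.+1) (fm : forall i, {linear V i -> dform R d.+1})
    (dh : forall i, {linear V i -> V i.+1})
    (X : vectType R) (vf : {linear X -> vfield R d.+1})
    (D : forall i : nat, set (dform R d.+1))
    (Pi : forall i, dform R d.+1 -> V i)
    (u : X) (a : V d.+1) :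
  stokes_domain vol Om sigma nu ->
  discrete_forms vol sigma Om fm dh ->
  discrete_fields vol sigma Om nu vf ->
  trace_projections sigma Om nu fm vf D Pi ->
  total_mass (fm := fm) vol Om (Aop fm dh vf Pi u a) = 0.
Proof.
move=> hOm H1 hX H2 /=; rewrite (dh_top a H1) linear0.
have -> : interior_prod (vf u) 0 = 0 :> dform R d.+1.
  by apply/funext => x; exact: ext_contract0r.
rewrite (Pi0 _ H2) addr0 /total_mass.
apply: (stokes_vanishing_trace hOm _ _ (fm_degree H1 _)
  (fm_regular H1 _) (fm_regular H1 _) (dhE H1 _)) => //=.
  exact: (fm_degree H1 _).
apply: (Pi_trace H2); first exact: (D_interior H2).
apply: (vanishing_trace_interior_prod erefl (nu_unit hOm) (vf_tangent hX u)).
  exact: (fm_degree H1).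
exact: (fm_regular H1).
Qed.

Theorem proposition4 (R : realType) (n : nat) (hn : n = 2%N \/ n = 3%N)
  (vol : {measure set (borelV R n) -> \bar R}) (hvol : is_lebesgue vol)
  (Om : set 'rV[R]_n) (sigma : {measure set (borelV R n) -> \bar R})
  (nu : vfield R n) (hOm : stokes_domain vol Om sigma nu)
  (E : set (R * R)) (e : R * R -> R) (hE : open E) (he : smooth_on E e)
  (V : nat -> vectType R) (fm : forall i, {linear V i -> dform R n})
  (dh : forall i, {linear V i -> V i.+1})
  (H1 : discrete_forms vol sigma Om fm dh)
  (X : vectType R) (vf : {linear X -> vfield R n})
  (hX : discrete_fields vol sigma Om nu vf)
  (D : forall i : nat, set (dform R n)) (Pi : forall i, dform R n -> V i)
  (H2 : trace_projections sigma Om nu fm vf D Pi)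
  (hat : (forall i, V i -> V i) -> X)
  (H3 : gh_left_inverse fm dh vf Pi hat)
  (J : set R) (hJ : is_interval J)
  (u : R -> X) (rho vs : R -> V n) (beta : R -> V n.-1)
  (hS : scheme_solution vol Om fm dh vf Pi hat E e J u rho vs beta) :
  forall s t : R, J s -> J t ->
    \int[vol]_(x in Om) scalar_density fm (rho s) x =
    \int[vol]_(x in Om) scalar_density fm (rho t) x.
Proof.
have hL := total_mass_scalar (dom_open hOm) H1.
pose L : {scalar V n} := HB.pack (total_mass (fm := fm) vol Om)
  (GRing.isLinear.Build _ _ _ _ (total_mass (fm := fm) vol Om) hL).
have dL r : J r -> is_derive r 1 (L \o rho) 0.
  move=> Jr; have := is_derive_scalar_curve L (rho_smooth hS) Jr.
  have /eqP := rho_eq hS Jr; rewrite addr_eq0 => /eqP ->; rewrite linearN.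
  suff -> : L (Aop fm dh vf Pi (u r) (rho r)) = 0 by rewrite oppr0.
  by case: hn => en; subst n; exact: (total_mass_Aop _ _ hOm H1 hX H2).
suff lt s t : J s -> J t -> s < t -> L (rho s) = L (rho t).
  move=> s t Js Jt; rewrite -[LHS]/(L _) -[RHS]/(L _).
  have [st|ts|-> //] := ltgtP s t; first exact: lt.
  by apply/esym/lt.
move=> Js Jt st.
have sub x : x \in `[s, t] -> J x by rewrite in_itv; exact: hJ.
have derL x : x \in `]s, t[ -> is_derive x 1 (L \o rho) 0.
  by move=> xst; apply/dL/sub; exact: subset_itv_oo_cc.
have contL : {within `[s, t], continuous (L \o rho)}.
  by apply: derivable_within_continuous => x /sub/dL dx; exact: ex_derive.
have [c _ /eqP] := MVT st derL contL.
by rewrite mul0r subr_eq0 => /eqP/esym.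
Qed.
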